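(* For every positive integer $n$, $$\nu_2(\sigma(n)) \le \lceil \log_2 n\rceil,$$ and equality holds if and only if $n$ is a product of distinct Mersenne primes.
   Context: $\nu_2(m)$ denotes the exponent of the highest power of $2$ dividing the positive integer $m$, and $\sigma(n)$ is the sum of the positive divisors of $n$. A Mersenne prime is a prime of the form $2^a-1$ with $a$ a positive integer. The number $n=1$ is regarded as the empty product of Mersenne primes. *)

(* Defs.v *)
From mathcomp Require Import all_boot all_order all_algebra.
From mathcomp Require Import reals exp.

Set Implicit Arguments.
Unset Strict Implicit.
Unset Printing Implicit Defensive.

Import Order.TTheory GRing.Theory Num.Theory.

Definition sigma (n : nat) : nat := \sum_(d <- divisors n) d.

(* The truncated subtraction is harmless, since 2 ^ a >= 1. *)
Definition mersenne_prime (p : nat) : Prop :=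
  prime p /\ exists2 a, 0 < a & p = 2 ^ a - 1.

(* The empty list is allowed, so 1 qualifies as the empty product. *)
Definition prod_distinct_mersenne (n : nat) : Prop :=
  exists s : seq nat,
    [/\ uniq s, forall p, p \in s -> mersenne_prime p
      & n = \prod_(p <- s) p].

Definition log2 (R : realType) (x : R) : R := (ln x / ln 2)%R.

(* Main.v *)
Require Import Defs.
From mathcomp Require Import all_boot all_order all_algebra.
From mathcomp Require Import reals exp.
From mathcomp Require Import zify.

(** Write [f n] for the 2-part of [sigma n], a multiplicative function.  If
    [sigma (p ^ a)] is not a power of 2, its odd part is at least 3 while
    [sigma (p ^ a) <= 3/2 p ^ a], so [2 f (p ^ a) <= p ^ a]; and it is a power
    of 2 only if [a = 1] and [p] is a Mersenne prime.  Hence [n = m k] with [m]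
    a product of distinct Mersenne primes and [k = 1] or [2 f k <= k].  Since
    [f m / m] is the product of the [(1 - 2 ^ -a)^-1] over distinct [a >= 2],
    it is less than 2; so [f n < 2 n] always, and [n <= f n] iff [k = 1]. *)

Import Order.TTheory GRing.Theory Num.Theory.

(** * Multiplicativity of [sigma] and its values at prime powers *)

Lemma sigma_gt0 n : 0 < n -> 0 < sigma n.
Proof. by move=> n0; rewrite /sigma (big_rem n) ?divisors_id //= addn_gt0 n0. Qed.

Lemma sigma1 : sigma 1 = 1.
Proof. by rewrite /sigma big_seq1. Qed.

(** A divisor [x] of [m * n] factors uniquely as [gcdn x m * gcdn x n], so the divisors of [m * n]
    are the products [d * e], each occurring once. *)
Lemma sigmaM m n : 0 < m -> 0 < n -> coprime m n ->
  sigma (m * n) = sigma m * sigma n.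
Proof.
move=> m0 n0 cop.
have P : perm_eq (divisors (m * n))
                 [seq d * e | d <- divisors m, e <- divisors n].
  apply: uniq_perm (divisors_uniq _) _ _.
    apply: allpairs_uniq; rewrite ?divisors_uniq //.
    have gcdE d e : d %| m -> e %| n -> gcdn m (d * e) = d /\ gcdn n (d * e) = e.
      move=> dm en; split.
        by rewrite Gauss_gcdl ?(coprime_dvdr en) //; apply/gcdn_idPr.
      by rewrite Gauss_gcdr ?(coprime_dvdr dm) 1?coprime_sym //; apply/gcdn_idPr.
    move=> _ _ /allpairsP[[a b] /= [ha hb ->]] /allpairsP[[c d] /= [hc hd ->]] /= E.
    move: ha hb hc hd; rewrite -!dvdn_divisors // => ha hb hc hd.
    have [A B] := gcdE _ _ ha hb; have [C D] := gcdE _ _ hc hd.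
    by congr pair; [rewrite -A E C | rewrite -B E D].
  move=> x; rewrite -dvdn_divisors ?muln_gt0 ?m0 //; apply/idP/allpairsP.
    move=> xmn; exists (gcdn x m, gcdn x n).
    rewrite /= -!dvdn_divisors // !dvdn_gcdr; split=> //.
    apply/eqP; rewrite eqn_dvd Gauss_dvd ?dvdn_gcdl ?andbT; last first.
      by apply: coprime_dvdl (dvdn_gcdr _ _) _; apply: coprime_dvdr cop; exact: dvdn_gcdr.
    rewrite muln_gcdl dvdn_gcd dvdn_mulr //= muln_gcdr dvdn_gcd xmn andbT.
    by rewrite dvdn_mull.
  move=> [[d e] /= [hd he ->]]; move: hd he; rewrite -!dvdn_divisors //.
  exact: dvdn_mul.
rewrite /sigma (perm_big _ P) big_allpairs_dep /= big_distrl.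
by apply: eq_bigr => d _; rewrite big_distrr.
Qed.

Lemma sigma_pfactor p a : prime p -> sigma (p ^ a) = \sum_(i < a.+1) p ^ i.
Proof.
move=> pp; have p1 := prime_gt1 pp.
have P : perm_eq (divisors (p ^ a)) [seq p ^ i | i <- iota 0 a.+1].
  apply: uniq_perm (divisors_uniq _) _ _.
    by rewrite map_inj_uniq ?iota_uniq //; exact: expnI.
  move=> x; rewrite -dvdn_divisors ?expn_gt0 ?prime_gt0 //.
  apply/dvdn_pfactor/mapP => // -[i hi ->]; exists i => //.
    by rewrite mem_iota.
  by move: hi; rewrite mem_iota.
by rewrite /sigma (perm_big _ P) big_map -(big_mkord xpredT (expn p)) /index_iota subn0.
Qed.

Lemma sigma_prime p : prime p -> sigma p = p.+1.
Proof.
move=> pp; rewrite -[p in sigma p]expn1 sigma_pfactor //.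
by rewrite !big_ord_recr big_ord0 /= expn0 expn1 add0n add1n.
Qed.

(** * Prime powers: when [sigma] is a power of 2, and its 2-part otherwise *)

Lemma geom_double q c :
  \sum_(i < c.*2) q ^ i = q.+1 * \sum_(i < c) (q ^ 2) ^ i.
Proof.
elim: c => [|c IH]; first by rewrite !big_ord0 muln0.
rewrite doubleS !big_ord_recr /= IH mulnDr -addnA; congr (_ + _).
by rewrite -expnM mul2n expnS mulSn addnC mulnC.
Qed.

Lemma odd_geom q c : odd q -> odd (\sum_(i < c) q ^ i) = odd c.
Proof.
move=> oq; elim: c => [|c IH]; first by rewrite big_ord0.
by rewrite big_ord_recr oddD IH oddX oq orbT addbT.
Qed.

Lemma geom_gt1 q c : 0 < q -> 1 < c -> 1 < \sum_(i < c) q ^ i.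
Proof.
case: c => [|[|c]] // q0 _.
rewrite 2!big_ord_recl /= expn0 -{1}[1]addn0 ltn_add2l.
by rewrite ltn_addr // expn_gt0 q0.
Qed.

Lemma dvdn_pow2 d k : d %| 2 ^ k -> exists j, d = 2 ^ j.
Proof. by case/dvdn_pfactor => // j _ ->; exists j. Qed.

(** The sum exceeds 1, so as a power of 2 it is even; its [c] terms are odd, so [c] is even. Pairing
    consecutive terms then pulls out the factor [q.+1]. *)
Lemma geom_pow2 q c k : odd q -> 1 < c -> \sum_(i < c) q ^ i = 2 ^ k ->
  c = c./2.*2 /\ q.+1 * \sum_(i < c./2) (q ^ 2) ^ i = 2 ^ k.
Proof.
move=> oq c1 E.
have ec : c = c./2.*2.
  rewrite -[LHS]odd_double_half -(odd_geom _ c oq) E.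
  suff -> : odd (2 ^ k) = false by [].
  rewrite oddX /= orbF; apply/negbTE/negP => /eqP k0.
  by have := geom_gt1 q c (odd_gt0 oq) c1; rewrite E k0.
by split=> //; rewrite -geom_double -ec.
Qed.

Lemma odd_sigma_pow2 a : odd (sigma (2 ^ a)).
Proof.
rewrite sigma_pfactor // big_ord_recl expn0 oddD.
by rewrite (big_morph odd oddD (erefl (odd 0))) big1 // => i _; rewrite oddX.
Qed.

(** Write [a.+1 = 2 * c]. If [c > 1], the cofactor of [p.+1] is a geometric sum in [p ^ 2] that is
    again a power of 2, so a second use of [geom_pow2] makes [(p ^ 2).+1] a power of 2, which is
    impossible modulo 4. *)
Lemma sigma_pfactor_pow2 p a k : prime p -> odd p -> 0 < a ->
  sigma (p ^ a) = 2 ^ k -> a = 1 /\ p.+1 = 2 ^ k.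
Proof.
move=> pp op a0; have p1 := prime_gt1 pp; rewrite sigma_pfactor // => E.
have [Ea] := geom_pow2 p a.+1 k op a0 E; set c := _./2 in Ea *.
case: (leqP c 1) => [c1|c1] Ek.
  have c_1 : c = 1 by lia.
  split; first by lia.
  by rewrite -Ek c_1 big_ord_recl big_ord0 muln1.
have [j Ej] : exists j, \sum_(i < c) (p ^ 2) ^ i = 2 ^ j.
  by apply: (@dvdn_pow2 _ k); rewrite -Ek dvdn_mull.
have op2 : odd (p ^ 2) by rewrite oddX op orbT.
have [_ Ej'] := geom_pow2 _ c j op2 c1 Ej.
have [l El] : exists l, (p ^ 2).+1 = 2 ^ l.
  by apply: (@dvdn_pow2 _ j); rewrite -Ej' dvdn_mulr.
(* [p ^ 2 + 1] is 2 modulo 4, hence not a larger power of 2. *)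
exfalso; move: El; case: l => [|[|l]].
- by rewrite expn0 => -[/eqP]; rewrite expn_eq0; lia.
- by rewrite expn1 => -[/eqP]; rewrite -[X in _ == X](exp1n 2) eqn_exp2r //; lia.
- have [h ->] : exists h, p = h * 2 + 1.
    by exists p./2; rewrite muln2 addn1 -[LHS]odd_double_half op.
  by rewrite -mulnn ![2 ^ _.+1]expnS; move: (2 ^ l) => L; nia.
Qed.

(** The ratio 3/2 is the limit [p / (p - 1)] of the geometric series at the smallest odd prime,
    [p = 3]. *)
Lemma sigma_pfactor_le p a : prime p -> odd p ->
  2 * sigma (p ^ a) <= 3 * p ^ a.
Proof.
move=> pp op; rewrite sigma_pfactor //; have p3 := odd_prime_gt2 op pp.
elim: a => [|a IH]; first by rewrite big_ord1.
rewrite big_ord_recr /= mulnDr (mulnDl 1 2) mul1n leq_add2r (leq_trans IH) //.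
by rewrite expnS leq_mul2r p3 orbT.
Qed.

Lemma part2_pow2_or_le m : 0 < m -> (exists k, m = 2 ^ k) \/ 3 * m`_2 <= m.
Proof.
move=> m0; have E := partnC 2 m0.
have o : odd m`_2^' by rewrite odd_2'nat part_pnat.
case: (leqP m`_2^' 1) => h.
  have e : m`_2^' = 1 by move: o h; case: (m`_2^') => [|[|]].
  by left; exists (logn 2 m); rewrite -p_part -[LHS]E e muln1.
right; rewrite -[X in _ <= X]E mulnC leq_mul2l; apply/orP; right.
by move: o h; case: (m`_2^') => [|[|[|]]].
Qed.

(** For [p = 2] the 2-part is 1, because [sigma (2 ^ a)] is odd. For odd [p], unless [sigma (p ^ a)]
    is a power of 2, three times its 2-part is at most [sigma (p ^ a)], hence at most 3/2 of
    [p ^ a]. *)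
Lemma sigma_pfactor_part2_le p a : prime p -> 0 < a ->
  2 * (sigma (p ^ a))`_2 <= p ^ a \/ a = 1 /\ mersenne_prime p.
Proof.
move=> pp a0; case: (even_prime pp) => [p2|op].
  left; rewrite p2 part_p'nat -?odd_2'nat ?odd_sigma_pow2 //.
  by rewrite muln1 -{1}[2]expn1 leq_exp2l.
have pa0 : 0 < p ^ a by rewrite expn_gt0 prime_gt0.
case: (part2_pow2_or_le _ (sigma_gt0 _ pa0)) => [[k Ek]|le3]; last first.
  by left; have := sigma_pfactor_le p a pp op; lia.
have [-> Ep] := sigma_pfactor_pow2 p a k pp op a0 Ek.
right; split=> //; split=> //; exists k; last by rewrite -Ep subn1.
by case: k Ep {Ek} => // -[p0]; move: pp; rewrite p0.
Qed.

(** * Products of distinct Mersenne primes *)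

Lemma mersenne_primeS p : mersenne_prime p -> exists2 a, 1 < a & p.+1 = 2 ^ a.
Proof.
case=> pp [a a0 Ep]; have Ea : p.+1 = 2 ^ a.
  by rewrite Ep subn1 prednK // expn_gt0.
by exists a => //; case: a a0 Ep {Ea} => [|[|]] // _ p1; move: pp; rewrite p1.
Qed.

Lemma coprime_prod_primes p (s : seq nat) : prime p ->
  (forall q, q \in s -> prime q) -> p \notin s -> coprime p (\prod_(q <- s) q).
Proof.
move=> pp; elim: s => [|q s IH] hs; first by rewrite big_nil coprimen1.
rewrite inE negb_or big_cons coprimeMr => /andP[pq ps].
rewrite IH // => [|r rs]; last by apply: hs; rewrite inE rs orbT.
by rewrite andbT prime_coprime // dvdn_prime2 // hs // inE eqxx.
Qed.

Lemma prod_primes_gt0 (s : seq nat) :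
  (forall q, q \in s -> prime q) -> 0 < \prod_(q <- s) q.
Proof. by move=> hs; rewrite big_seq; apply: prodn_cond_gt0 => q /hs/prime_gt0. Qed.

Lemma sigma_prod_primes (s : seq nat) : uniq s ->
  (forall q, q \in s -> prime q) -> sigma (\prod_(q <- s) q) = \prod_(q <- s) q.+1.
Proof.
elim: s => [|q s IH] /=; first by rewrite !big_nil sigma1.
case/andP=> qs us hs; have hs' r : r \in s -> prime r.
  by move=> rs; apply: hs; rewrite inE rs orbT.
have pq : prime q by apply: hs; rewrite inE eqxx.
rewrite !big_cons sigmaM ?prod_primes_gt0 ?(prime_gt0 pq) ?coprime_prod_primes //.
by rewrite sigma_prime // IH.
Qed.

Lemma sigma_prod_mersenne_part2 (s : seq nat) : uniq s ->
  (forall p, p \in s -> mersenne_prime p) ->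
  (sigma (\prod_(p <- s) p))`_2 = \prod_(p <- s) p.+1.
Proof.
move=> us hs; rewrite sigma_prod_primes // => [|p /hs[]] //.
apply: part_pnat_id; rewrite big_seq.
apply: (big_ind (fun m => 2.-nat m)) => // [m n hm hn|p /hs /mersenne_primeS[a _ ->]].
  by rewrite pnatM hm.
by rewrite pnatX pnat_id.
Qed.

(* The finite form of [\prod_(2 <= a <= N) (1 - 2 ^ -a) >= 1/2 + 2 ^ -N]. *)
Lemma prod_pow2_pred_ge N (s : seq nat) : 0 < N -> uniq s ->
  (forall p, p \in s -> exists2 a, 1 < a <= N & p.+1 = 2 ^ a) ->
  (2 ^ N + 2) * \prod_(p <- s) p.+1 <= 2 ^ N.+1 * \prod_(p <- s) p.
Proof.
case: N => // N _; elim: N s => [|N IH] s us hs.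
  case: s us hs => [|p s] _ hs; first by rewrite !big_nil.
  by have [a] := hs p (mem_head _ _); lia.
have M2 : 2 <= 2 ^ N.+1 by rewrite expnS leq_pmulr // expn_gt0.
(* Only this [p] can have exponent [N.+2]; once it is absent or removed, the induction hypothesis
   applies. *)
pose p := (2 ^ N.+2).-1; have Ep : p.+1 = 2 ^ N.+2 by rewrite prednK // expn_gt0.
have small (t : seq nat) : {subset t <= s} -> p \notin t ->
    forall q, q \in t -> exists2 a, 1 < a <= N.+1 & q.+1 = 2 ^ a.
  move=> ts pt q qt; have [a /andP[a1 aN] Eq] := hs q (ts _ qt).
  exists a => //; rewrite a1 /=; move: aN; rewrite leq_eqVlt => /orP[/eqP aN|//].
  by move: pt; rewrite -[p]/(p.+1.-1) Ep -aN -Eq qt.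
case: (boolP (p \in s)) => ps; last first.
  have := IH s us (small s (fun _ h => h) ps).
  rewrite [2 ^ N.+2]expnS [2 ^ N.+3]expnS [2 ^ N.+2]expnS.
  move: (2 ^ N.+1) M2 (\prod_(p <- s) p.+1) (\prod_(p <- s) p) => M M2 Q P; nia.
have := IH (rem p s) (rem_uniq _ us)
  (small _ (@mem_rem _ _ _) (negbT (mem_rem_uniqF p us))).
rewrite (big_rem p ps) /= [in X in _ -> _ <= X](big_rem p ps) /= Ep.
have -> : p = 2 * 2 ^ N.+1 - 1 by rewrite -expnS -Ep; lia.
rewrite [2 ^ N.+3]expnS [2 ^ N.+2]expnS.
(* By [H] it suffices that [2 * M * (2 * M + 2) <= 2 * (2 * M - 1) * (M + 2)], which amounts to
   [2 <= M]. *)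
move: (2 ^ N.+1) M2 (\prod_(p <- _) p.+1) (\prod_(p <- _) p) => M M2 Q P H; nia.
Qed.

(** Strictness comes from the extra 2 in the factor [2 ^ N + 2] of the finite bound. *)
Lemma prod_mersenne_lt (s : seq nat) : uniq s ->
  (forall p, p \in s -> mersenne_prime p) ->
  \prod_(p <- s) p.+1 < 2 * \prod_(p <- s) p.
Proof.
(* This [N] bounds every exponent, since [a < 2 ^ a = p.+1]. *)
move=> us hs; pose N := (\max_(p <- s) p).+1.
have bound p : p \in s -> exists2 a, 1 < a <= N & p.+1 = 2 ^ a.
  move=> ps; have [a a1 Ep] := mersenne_primeS p (hs p ps).
  exists a => //; rewrite a1 /=.
  have pN : p <= \max_(q <- s) q by exact: leq_bigmax_seq.
  by have := ltn_expl a (isT : 1 < 2); rewrite -Ep /N; lia.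
have := prod_pow2_pred_ge N s isT us bound.
have Q0 : 0 < \prod_(p <- s) p.+1 by exact: prodn_gt0.
have M0 : 0 < 2 ^ N by rewrite expn_gt0.
rewrite [2 ^ N.+1]expnS.
move: (2 ^ N) M0 (\prod_(p <- s) p.+1) Q0 (\prod_(p <- s) p) => M M0 Q Q0 P; nia.
Qed.

(** * Splitting off the Mersenne primes, and the bounds on the 2-part *)

Lemma mersenne_decomposition n : 0 < n -> exists (s : seq nat) (k : nat),
  [/\ uniq s, forall p, p \in s -> mersenne_prime p, n = \prod_(p <- s) p * k,
      coprime (\prod_(p <- s) p) k & k = 1 \/ 2 * (sigma k)`_2 <= k].
Proof.
elim/ltn_ind: n => n IH n0; case: (leqP n 1) => n1.
  by exists [::], 1; rewrite big_nil; split=> //; [lia | left].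
have pp := pdiv_prime n1; set p := pdiv n in pp.
have [m pm En] := pfactor_coprime pp n0.
have a0 : 0 < logn p n by rewrite logn_gt0 mem_primes pp n0 pdiv_dvd.
move: (logn p n) a0 En => a a0 En.
have m0 : 0 < m by move: n0; rewrite En muln_gt0 => /andP[].
have mn : m < n by rewrite En ltn_Pmulr // -(expn0 p) ltn_exp2l ?prime_gt1.
have [s [k [us hs Em ck bk]]] := IH m mn m0.
have [ps pk] : coprime p (\prod_(q <- s) q) /\ coprime p k.
  by apply/andP; rewrite -coprimeMr -Em.
have k0 : 0 < k by move: m0; rewrite Em muln_gt0 => /andP[].
(* The full power [p ^ a] is absorbed into [k], or else [a = 1] and [p] joins [s]. *)
case: (sigma_pfactor_part2_le p a pp a0) => [le_pa|[a_1 mp]].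
  exists s, (p ^ a * k); split=> //.
  - by rewrite En Em -mulnA [k * _]mulnC.
  - by rewrite coprimeMr ck andbT coprime_sym coprimeXl.
  have pa0 : 0 < p ^ a by rewrite expn_gt0 prime_gt0.
  (* The factor 2 goes to [p ^ a]; in both cases of [bk] the 2-part of [sigma k] is at most [k]. *)
  right; rewrite sigmaM ?coprimeXl // partnM ?sigma_gt0 // mulnA leq_mul //.
  by case: bk => [->|]; [rewrite sigma1 partn1 | lia].
exists (p :: s), k; split=> //.
- rewrite /= us andbT; apply: contraL ps => ps.
  by rewrite prime_coprime // negbK (big_rem p ps) dvdn_mulr.
- by move=> q; rewrite inE => /orP[/eqP->|/hs].
- by rewrite En Em a_1 expn1 big_cons mulnC mulnA.
- by rewrite big_cons coprimeMl pk.
Qed.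

(** The multiplicative form of the theorem: [n <= 2 ^ v], with [v] the 2-adic valuation of
    [sigma n], says that [v] reaches the ceiling of the logarithm. *)
Lemma sigma_part2_bounds n : 0 < n ->
  (sigma n)`_2 < 2 * n /\ (n <= (sigma n)`_2 <-> prod_distinct_mersenne n).
Proof.
move=> n0; have [s [k [us hs En ck bk]]] := mersenne_decomposition n n0.
have [P0 k0] : 0 < \prod_(p <- s) p /\ 0 < k.
  by apply/andP; rewrite -muln_gt0 -En.
have f_n : (sigma n)`_2 = \prod_(p <- s) p.+1 * (sigma k)`_2.
  by rewrite En sigmaM // partnM ?sigma_gt0 // sigma_prod_mersenne_part2.
have lt_2P := prod_mersenne_lt s us hs.
have fk0 : 0 < (sigma k)`_2 by exact: part_gt0.
have lt_n : k <> 1 -> (sigma n)`_2 < n.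
  case: bk => // le_k _; rewrite f_n En.
  have : \prod_(p <- s) p.+1 * (sigma k)`_2 < 2 * \prod_(p <- s) p * (sigma k)`_2.
    by rewrite ltn_pmul2r.
  by move/leq_trans; apply; rewrite -mulnA mulnCA leq_mul2l le_k orbT.
split; last split.
- case: (eqVneq k 1) => [k1|/eqP/lt_n]; last by lia.
  by rewrite f_n En k1 sigma1 partn1 !muln1.
- case: (eqVneq k 1) => [k1 _|/eqP/lt_n]; last by lia.
  by exists s; split=> //; rewrite En k1 muln1.
- move=> [t [ut ht ->]]; rewrite sigma_prod_mersenne_part2 //.
  by apply: leq_prod => p _.
Qed.

(** * From 2-parts to the ceiling of the logarithm *)

Lemma ceil_log2 (R : realType) n : 0 < n ->
  Num.ceil (log2 (n%:R : R)) = Posz (up_log 2 n).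
Proof.
move=> n0; have ln2 : (0 < ln (2 : R))%R by rewrite ln_gt0 // ltr1n.
(* This identifies the ceiling with [up_log 2 n], the least [k] such that [n <= 2 ^ k]. *)
have le_log k : (log2 (n%:R : R) <= k%:R)%R = (n <= 2 ^ k).
  rewrite /log2 ler_pdivrMr // mulr_natl -lnXn ?ltr0n //.
  by rewrite ler_ln ?posrE ?exprn_gt0 ?ltr0n // -natrX ler_nat.
apply/eqP; rewrite eq_le ceil_le_int le_log up_logP //=.
(* At [n = 1], [up_log] is 0 and has no predecessor at which to test the lower bound. *)
case: (leqP n 1) => n1.
  have -> : n = 1 by lia.
  by rewrite up_log1 /log2 ln1 mul0r ceil0.
have /andP[lt_n _] := up_log_bounds (isT : 1 < 2) n1.
have u0 : 0 < up_log 2 n by rewrite up_log_gt0.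
rewrite -[up_log 2 n]prednK // -addn1 PoszD lezD1 ceil_gt_int.
by rewrite real_ltNge ?num_real // le_log -ltnNge.
Qed.

Theorem theorem1p3 (R : realType) (n : nat) (hn : 0 < n) :
  (Posz (logn 2 (sigma n)) <= Num.ceil (log2 (n%:R : R)))%R
  /\ (Posz (logn 2 (sigma n)) = Num.ceil (log2 (n%:R : R))
      <-> prod_distinct_mersenne n).
Proof.
have [lt_2n <-] := sigma_part2_bounds n hn.
rewrite ceil_log2 // p_part; rewrite p_part in lt_2n.
(* The 2-part is below [2 * n], and [up_log 2 (2 * n)] is [(up_log 2 n).+1]. *)
have le_up : logn 2 (sigma n) <= up_log 2 n.
  rewrite -ltnS -up_logMp // -(ltn_exp2l _ _ (isT : 1 < 2)).
  exact: leq_trans lt_2n (up_logP _ _).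
split; first by rewrite lez_nat.
split=> [[->]|le_n]; first exact: up_logP.
by congr Posz; apply/eqP; rewrite eqn_leq le_up up_log_min.
Qed.
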